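(* For every pair of integers $n,m$ with $n\ge 2$, $m\ge 3$, there exists $Q\in X_n^m$ such that its associated form $\mathbf{Q}$ satisfies $\Delta(\mathbf{Q})\ne 0$.
   Context: $\mathcal{Q}_n^m$ is the complex vector space of forms (homogeneous polynomials) of degree $m$ on $\mathbb{C}^n$. The discriminant $\Delta$ satisfies: for a form $Q$ of degree at least $2$, $\Delta(Q)\neq 0$ if and only if the first-order partial derivatives $Q_j:=\partial Q/\partial z_j$, $j=1,\dots,n$, have no common zero in $\mathbb{C}^n\setminus\{0\}$. For $m\ge 3$, $X_n^m:=\{Q\in\mathcal{Q}_n^m:\Delta(Q)\ne 0\}$. Associated form: for $Q\in X_n^m$ let $M(Q):=\mathbb{C}[z_1,\dots,z_n]/J(Q)$, where $J(Q)$ is the ideal generated by $Q_1,\dots,Q_n$ (the Milnor algebra). It is a local Artinian Gorenstein algebra; with $\mathfrak{m}$ its maximal ideal, $\mathrm{Soc}(M(Q)):=\{x\in\mathfrak{m}:x\mathfrak{m}=0\}$ is one-dimensional, equals $\mathfrak{m}^{n(m-2)}$, and is spanned by the element $e_0$ represented by the Hessian determinant $\mathrm{Hess}(Q)=\det(\partial^2Q/\partial z_i\partial z_j)$. Let $\omega:\mathrm{Soc}(M(Q))\to\mathbb{C}$ be the linear isomorphism with $\omega(e_0)=1$, and let $e_j$ be the element of $M(Q)$ represented by $z_j$. The associated form of $Q$ is $\mathbf{Q}\in\mathcal{Q}_n^{n(m-2)}$, $\mathbf{Q}(z):=\omega\left((z_1e_1+\dots+z_ne_n)^{n(m-2)}\right)$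 for $z=(z_1,\dots,z_n)\in\mathbb{C}^n$. *)

(* Defs.v *)
From HB Require Import structures.
From mathcomp Require Import all_boot all_order all_algebra.
From mathcomp Require Import ring_quotient.
From mathcomp Require Import boolp reals.
From mathcomp Require Import complex mpoly.

Set Implicit Arguments.
Unset Strict Implicit.
Unset Printing Implicit Defensive.

Import GRing.Theory.
Local Open Scope ring_scope.
Local Open Scope quotient_scope.

(* Forms of degree m on C^n, the zero form included, are the elements of the  *)
(* vector space [dhomog n C m] of multinomials.  The definitions below make   *)
(* sense over any field C; the theorem is stated for C = R[i] with            *)
(* R : realType.                                                              *)

Section Discriminant.
Variables (C : fieldType) (n : nat).

(* The discriminant (for each degree d, a function of forms of degree d)      *)
(* enters only through its vanishing locus in degrees at least 2, which is    *)
(* the locus of forms whose partial derivatives have a common zero in         *)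
(* C^n \ {0}.  No normalization of its nonzero values is fixed.               *)
Definition is_discriminant (Delta : forall d, dhomog n C d -> C) : Prop :=
  forall d (Q : dhomog n C d), (2 <= d)%N ->
    (Delta d Q != 0 <->
     ~ exists z : 'I_n -> C,
         (exists j, z j != 0) /\ (forall j, (Q^`M(j)).@[z] = 0)).

End Discriminant.

Definition hessian (C : fieldType) (n : nat) (Q : {mpoly C[n]}) : {mpoly C[n]} :=
  \det (\matrix_(i < n, j < n) Q^`M(j)^`M(i)).

Section MilnorAlgebra.
Variables (C : fieldType) (n m : nat) (m_ge3 : (3 <= m)%N) (Q : dhomog n C m).

(* m_ge3 is not used in the body: it is carried along because {ideal_quot _}  *)
(* requires a proper ideal.                                                   *)
Definition jacobian_ideal of (3 <= m)%N : {pred {mpoly C[n]}} :=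
  fun p => `[< exists g : 'I_n -> {mpoly C[n]},
                 p = \sum_(j < n) g j * Q^`M(j) >].

Local Notation J := (jacobian_ideal m_ge3).

Fact jacobian_ideal_closed : idealr_closed J.
Proof.
split.
- by apply/asboolP; exists (fun=> 0); rewrite big1 // => j _; rewrite mul0r.
- apply/asboolP => -[g /(congr1 (mcoeff 0%MM))].
  rewrite mcoeff1 eqxx raddf_sum /= big1; first by move/eqP; rewrite oner_eq0.
  move=> j _; have Qj0 : Q@_(0 + U_(j))%MM = 0.
    apply: (dhomog_nemf_coeff (dhomog_is_dhomog Q)).
    by rewrite add0m /= mdeg1; apply/eqP => m1; move: m_ge3; rewrite -m1.
  by rewrite rmorphM /= mcoeff_mderiv Qj0 mul0rn mulr0.
- move=> a p q /asboolP[g ->] /asboolP[h ->]; apply/asboolP.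
  exists (fun j => a * g j + h j).
  rewrite mulr_sumr -big_split /=; apply: eq_bigr => j _.
  by rewrite mulrDl mulrA.
Qed.

HB.instance Definition _ := isIdealr.Build {mpoly C[n]} J jacobian_ideal_closed.

Definition milnor : comNzRingType := {ideal_quot J}.

Definition milnor_class (p : {mpoly C[n]}) : milnor := \pi_({ideal_quot J}) p.

Definition milnor_scalar (c : C) : milnor := milnor_class c%:MP.

Definition milnor_var (j : 'I_n) : milnor := milnor_class 'X_j.

(* When Delta(Q) != 0 the Milnor algebra is local, so that its maximal ideal  *)
(* is the set of its non-invertible elements.                                 *)
Definition milnor_max (x : milnor) : Prop := ~ exists y : milnor, x * y = 1.

Definition milnor_soc (x : milnor) : Prop :=
  milnor_max x /\ forall y : milnor, milnor_max y -> x * y = 0.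

(* A function on the whole algebra of which only the restriction to the       *)
(* socle matters.  As the socle is the line spanned by the class of the       *)
(* Hessian when Delta(Q) != 0, that restriction is determined, and is         *)
(* automatically an isomorphism onto C.                                       *)
Definition is_omega (omega : milnor -> C) : Prop :=
  (forall (c : C) (x y : milnor), milnor_soc x -> milnor_soc y ->
     omega (milnor_scalar c * x + y) = c * omega x + omega y) /\
  omega (milnor_class (hessian Q)) = 1.

Definition is_associated_form (F : dhomog n C (n * (m - 2))) : Prop :=
  exists2 omega : milnor -> C, is_omega omega &
    forall z : 'I_n -> C,
      F.@[z] = omega ((\sum_(j < n) milnor_scalar (z j) * milnor_var j)
                        ^+ (n * (m - 2))).

End MilnorAlgebra.

(* Main.v *)
Require Import Defs.
From HB Require Import structures.
From mathcomp Require Import all_boot all_order all_algebra.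
From mathcomp Require Import perm cyclic separable cyclotomic ring_quotient.
From mathcomp Require Import boolp reals.
From mathcomp Require Import complex mpoly.
From mathcomp Require Import zify ring lra.

(* Put d = m - 1, N = n (m - 2) and let Q be the form                         *)
(*   sum_i z_i ^ m - tau ^ (- d) (sum_i z_i) ^ m.                             *)
(* Its partial derivatives are the m (z_i ^ d - (sigma / tau) ^ d), where     *)
(* sigma = sum_i z_i, so Q is nonsingular unless tau = sigma (zeta) for some  *)
(* zeta with zeta_i ^ d = 1 for all i.  A residue computation suggests the    *)
(* functional                                                                 *)
(*   g |-> sum_zeta g (zeta) (prod_i zeta_i) / (sigma (zeta) - tau)           *)
(* on the forms of degree N, the sum being over all such zeta.  It vanishes   *)
(* on the Jacobian ideal and not at the Hessian, because a monomial sums to 0 *)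
(* over all zeta unless d divides all its exponents.  Hence the associated    *)
(* form is, up to a nonzero factor,                                           *)
(*   F (z) = sum_zeta (prod_i zeta_i) (zeta . z) ^ N / (sigma (zeta) - tau).  *)
(* Let om be a d-th root of unity other than 1 of maximal real part.  Then    *)
(* sigma (zeta) = n - 1 + om only for the n points zeta having one coordinate *)
(* om and the others 1, and these points are linearly independent unless      *)
(* n = 2 and om = -1.  As tau tends to n - 1 + om, their terms dominate F,    *)
(* which is thus close to a sum of N-th powers of n independent linear forms  *)
(* and hence nonsingular.  The case n = 2, m = 3 is settled with tau = 1.     *)

Set Implicit Arguments.
Unset Strict Implicit.
Unset Printing Implicit Defensive.

Import Order.TTheory GRing.Theory Num.Theory.
Local Open Scope ring_scope.
Local Open Scope quotient_scope.

(** Write sigma for the sum of the coordinates and d = m - 1. The functional [residue] is a sum over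
    the points zeta whose coordinates are d-th roots of unity. There a partial derivative of the
    form is m (1 - (sigma / tau) ^ d), which the factor 1 / (sigma - tau) turns into a polynomial of
    degree d - 1 in sigma. Orthogonality of roots of unity ([sum_root_point_eq0]) then yields
    [residue_jacobian] and [residue_hessian], and by [dual_form_associated] the associated form is
    an explicit weighted sum of N-th powers of the linear forms zeta . z.

    The weight of zeta has its pole at tau = sigma (zeta). For tau = nu - delta with delta small and
    nu = n - 1 + om, only n weights are large ([sum_roots_extreme]). Their points are the rows of
    the matrix with om on the diagonal and 1 elsewhere, which is invertible because its eigenvalues
    om - 1 and nu are nonzero. [grad_sum_unit_neq0] inverts this matrix twice, with bounds
    independent of delta. [nu_neq0] covers all cases but n = 2, m = 3, which is left to
    [exists_tau_binary]. *)

(** * Linear forms, their powers and derivatives *)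

Section PowerSums.
Variables (C : fieldType) (n : nat).
Implicit Types (p q : {mpoly C[n]}) (w : 'I_n -> C).

Definition linear_form w : {mpoly C[n]} := \sum_(i < n) w i *: 'X_i.

Lemma linear_form_homog w : linear_form w \is 1.-homog.
Proof. by apply: rpred_sum => i _; rewrite dhomogZ // dhomogX /= mdeg1. Qed.

Lemma linear_formX_homog w k : linear_form w ^+ k \is k.-homog.
Proof. by rewrite -[X in X.-homog]mul1n dhomogMn // linear_form_homog. Qed.

Lemma meval_linear_form w z : (linear_form w).@[z] = \sum_(i < n) w i * z i.
Proof.
by rewrite raddf_sum; apply: eq_bigr => i _; rewrite /= mevalZ mevalXU.
Qed.

Lemma mpolyXU_exp_homog i k : ('X_i : {mpoly C[n]}) ^+ k \is k.-homog.
Proof. by rewrite -[X in X.-homog]mul1n dhomogMn // dhomogX /= mdeg1. Qed.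

Lemma mderivXU i j : ('X_i : {mpoly C[n]})^`M(j) = (i == j)%:R.
Proof.
rewrite mderivX mnm1E; case: eqP => [->|_]; last by rewrite scale0r.
by rewrite -[X in (X - _)%MM]add0m addmK mpolyX0 scale1r.
Qed.

Lemma mderiv_linear_form w j : (linear_form w)^`M(j) = (w j)%:MP.
Proof.
rewrite raddf_sum (bigD1 j) //= mderivZ mderivXU eqxx big1 => [|i /negPf ij].
  by rewrite addr0 alg_mpolyC.
by rewrite /= mderivZ mderivXU ij scaler0.
Qed.

Lemma mderivXn p k j : (p ^+ k)^`M(j) = k%:R *: (p ^+ k.-1 * p^`M(j)).
Proof.
elim: k => [|k IHk]; first by rewrite scale0r expr0 -mpolyC1 mderivC.
rewrite exprS mderivM IHk /= -scalerAr mulrA -exprS mulrC -{1}[_ * _]scale1r.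
case: k {IHk} => [|k]; first by rewrite scale0r addr0.
by rewrite -scalerDl -mulrS.
Qed.

End PowerSums.

(** * Orthogonality of roots of unity *)

Section RootsOfUnity.
Variables (C : fieldType) (n d : nat) (e : C).
Hypothesis e_prim : d.-primitive_root e.
Implicit Types (f : {ffun 'I_n -> 'I_d}) (p : {mpoly C[n]}).

Definition root_point f : 'I_n -> C := fun i => e ^+ f i.
Definition coord_sum f := \sum_i root_point f i.
Definition coord_prod f := \prod_i root_point f i.

Lemma root_pointXd f i : root_point f i ^+ d = 1.
Proof. by rewrite exprAC (prim_expr_order e_prim) expr1n. Qed.

Lemma root_point_neq0 f i : root_point f i != 0.
Proof.
apply/eqP => z0; have /eqP := root_pointXd f i.
by rewrite z0 expr0n (gtn_eqF (prim_order_gt0 e_prim)) eq_sym oner_eq0.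
Qed.

Lemma sum_prim_root_exp_eq0 k : ~~ (d %| k)%N -> \sum_(j < d) (e ^+ j) ^+ k = 0.
Proof.
move=> dk; have ek1 : e ^+ k - 1 != 0.
  by rewrite subr_eq0 -(prim_order_dvd e_prim).
apply: (mulfI ek1); rewrite mulr0.
under eq_bigr => j _ do rewrite exprAC.
by rewrite -subrX1 exprAC (prim_expr_order e_prim) expr1n subrr.
Qed.

(** For a single monomial the sum over zeta factors into one-variable power sums of roots of unity,
    and the factor of index i is 0. *)
Lemma sum_root_point_eq0 s p :
    {in msupp p, forall a : 'X_{1..n}, exists i, ~~ (d %| a i + s)%N} ->
  \sum_f p.@[root_point f] * coord_prod f ^+ s = 0.
Proof.
move=> pP; under eq_bigr => f _ do rewrite mevalE mulr_suml.
rewrite exchange_big big_seq big1 //= => a /pP[i dvN].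
under eq_bigr => f _ do rewrite -mulrA -prodrXl -big_split /=.
rewrite -mulr_sumr.
pose g (i : 'I_n) (j : 'I_d) := (e ^+ j) ^+ (a i + s).
transitivity (p@_a * \sum_(f : {ffun 'I_n -> 'I_d}) \prod_i g i (f i)).
  congr (_ * _); apply: eq_bigr => f _; apply: eq_bigr => k _.
  by rewrite -exprD.
rewrite -bigA_distr_bigA /= (bigD1 i) //= sum_prim_root_exp_eq0 //.
by rewrite mul0r mulr0.
Qed.

End RootsOfUnity.

(** Two triangular factorizations of the same block matrix are compared. *)
Lemma det_1_sub_mulmx (R : comNzRingType) n (u : 'cV[R]_n) (v : 'rV[R]_n) :
  \det (1%:M - u *m v) = 1 - (v *m u) 0 0.
Proof.
have lE : block_mx 1%:M u v 1%:M =
    block_mx (1%:M - u *m v) u 0 1%:M *m block_mx 1%:M 0 v (1%:M : 'M_1).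
  by rewrite mulmx_block !mulmx1 !mul0mx !mul1mx mulmx0 !add0r subrK.
have rE : block_mx 1%:M u v 1%:M =
    block_mx 1%:M 0 v 1%:M *m block_mx 1%:M u 0 (1%:M - v *m u : 'M_1).
  by rewrite mulmx_block !mulmx1 !mulmx0 !mul0mx !mul1mx !addr0 addrC subrK.
have := congr1 (@determinant _ _) lE.
rewrite {}rE !det_mulmx !det_lblock !det_ublock !det1 !mul1r !mulr1 => <-.
by rewrite det_mx11 !mxE.
Qed.

Lemma pihomogM (R : nzRingType) n k l (p q : {mpoly R[n]}) :
  q \is l.-homog ->
  pihomog mdeg (k + l) (p * q) = pihomog mdeg k p * q.
Proof.
move=> hq; rewrite {1}[p]mpolyE mulr_suml raddf_sum /=.
rewrite [in RHS](mpolyE p) raddf_sum /= mulr_suml; apply: eq_bigr => a _.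
rewrite -scalerAl !linearZ /= -scalerAl pihomogX; congr (_ *: _).
have haq : 'X_[a] * q \is (mdeg a + l).-homog.
  by rewrite dhomogM // dhomogX.
case: eqP => [<-|/eqP ak]; first by rewrite pihomog_dE.
by rewrite mul0r (pihomog_ne0 _ haq) // eqn_add2r.
Qed.

(** * The deformed Fermat form and its residue functional *)

Section PowerSumForm.
Variables (C : numFieldType) (n m : nat) (m_gt2 : (2 < m)%N) (tau : C).
Let d := m.-1.
Let N := (n * (m - 2))%N.

Definition sum_form : {mpoly C[n]} := linear_form (fun=> 1).

Definition fermat_deformation : {mpoly C[n]} :=
  \sum_(i < n) 'X_i ^+ m - tau ^- d *: sum_form ^+ m.

Lemma meval_sum_form z : sum_form.@[z] = \sum_i z i.
Proof. by rewrite meval_linear_form; apply: eq_bigr => i _; rewrite mul1r. Qed.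

Lemma fermat_deformation_homog : fermat_deformation \is m.-homog.
Proof.
rewrite rpredB ?rpredZ ?linear_formX_homog // rpred_sum // => i _.
exact: mpolyXU_exp_homog.
Qed.

Lemma mderiv_fermat_deformation j :
  fermat_deformation^`M(j) =
    m%:R *: ('X_j ^+ d - tau ^- d *: sum_form ^+ d).
Proof.
rewrite mderivB mderivZ mderivXn mderiv_linear_form mulr1.
rewrite raddf_sum (bigD1 j) //=.
rewrite mderivXn mderivXU eqxx mulr1 big1 => [|i /negPf ij]; last first.
  by rewrite mderivXn mderivXU ij mulr0 scaler0.
by rewrite addr0 scalerBr !scalerA [_ * tau ^- _]mulrC.
Qed.

Lemma mderiv2_fermat_deformation i j : fermat_deformation^`M(j)^`M(i) =
  (m%:R * d%:R) *: ((i == j)%:R * 'X_j ^+ d.-1 - tau ^- d *: sum_form ^+ d.-1).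
Proof.
rewrite mderiv_fermat_deformation mderivZ mderivB mderivZ !mderivXn mderivXU.
rewrite mderiv_linear_form mulr1 -scalerA; congr (_ *: _).
by rewrite scalerBr !scalerA [_ * tau ^- _]mulrC [_ * _%:R]mulrC eq_sym.
Qed.

Lemma hessian_fermat_deformation_homog :
  hessian fermat_deformation \is N.-homog.
Proof.
rewrite rpred_sum // => s _; rewrite mulr_sign.
suff pP : \prod_(i < n) (\matrix_(i, j) fermat_deformation^`M(j)^`M(i))
    i (fun_of_perm s i) \is N.-homog.
  by case: ifP => // _; rewrite rpredN.
have -> : N = (\sum_(i < n) (m - 2))%N by rewrite sum_nat_const card_ord.
elim/big_rec2: _ => [|i p k _ hp]; first exact: dhomog1.
rewrite dhomogM // mxE mderiv2_fermat_deformation.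
have -> : (m - 2)%N = d.-1 by rewrite /d; lia.
rewrite rpredZ // rpredB ?rpredZ ?linear_formX_homog //.
case: eqP => _; last by rewrite mul0r rpred0.
by rewrite mul1r mpolyXU_exp_homog.
Qed.

Variable e : C.
Hypothesis e_prim : d.-primitive_root e.
Hypothesis tau_neq0 : tau != 0.
Hypothesis tauP : forall f : {ffun 'I_n -> 'I_d}, coord_sum e f != tau.

(** At a critical point every z_j ^ d equals (s / tau) ^ d. Either s = 0 and z = 0, or the z_j tau /
    s are d-th roots of unity with sum tau, against [tauP]. *)
Lemma fermat_deformation_nonsingular z :
  (forall j, (fermat_deformation^`M(j)).@[z] = 0) -> forall j, z j = 0.
Proof.
move=> Qz0; set s := \sum_i z i.
have zE j : z j ^+ d = (s / tau) ^+ d.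
  have /eqP := Qz0 j.
  rewrite mderiv_fermat_deformation mevalZ mulf_eq0 pnatr_eq0.
  rewrite gtn_eqF 1?(leq_trans _ m_gt2) //= mevalB mevalZ !rmorphXn /=.
  rewrite mevalXU meval_sum_form subr_eq0 => /eqP ->.
  by rewrite exprMn exprVn mulrC.
have d_gt0 : (0 < d)%N := prim_order_gt0 e_prim.
have [s0|s_neq0] := eqVneq s 0.
  move=> j; apply/eqP; move: (zE j); rewrite s0 mul0r expr0n gtn_eqF //.
  by move/eqP; rewrite expf_eq0 d_gt0.
have st_neq0 : s / tau != 0 by rewrite mulf_neq0 ?invr_neq0.
have fP j : exists a : 'I_d, z j / (s / tau) = e ^+ a.
  have [|i ->] := prim_rootP e_prim (x := z j / (s / tau)); last by exists i.
  by rewrite expr_div_n zE divff ?expf_neq0.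
have [f fE] := choice fP.
have /eqP[] := tauP [ffun j => f j].
rewrite /coord_sum; under eq_bigr => j _ do rewrite /root_point ffunE -fE.
by rewrite -mulr_suml -/s invf_div mulrC divfK.
Qed.

Definition residue (p : {mpoly C[n]}) :=
  \sum_(f : {ffun 'I_n -> 'I_d}) p.@[root_point e f] * coord_prod e f /
    (coord_sum e f - tau).

Lemma residue_is_linear : linear_for *%R residue.
Proof.
move=> c p q; rewrite /residue mulr_sumr -big_split; apply: eq_bigr => f _ /=.
by rewrite mevalD mevalZ !mulrDl !mulrA.
Qed.

HB.instance Definition _ :=
  GRing.isLinear.Build C {mpoly C[n]} C *%R residue residue_is_linear.

Lemma geometric_quotient (f : {ffun 'I_n -> 'I_d}) :
  (1 - tau ^- d * coord_sum e f ^+ d) / (coord_sum e f - tau) =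
    - (tau ^- d) * \sum_(i < d) coord_sum e f ^+ (d.-1 - i) * tau ^+ i.
Proof.
have s_tau : coord_sum e f - tau != 0 by rewrite subr_eq0.
apply: (mulIf s_tau); rewrite divfK // -mulrA [_ * (_ - _)]mulrC -subrXX.
by rewrite mulNr mulrBr mulVf ?expf_neq0 // opprB.
Qed.

(* As (1 - (sigma / tau) ^ d) / (sigma - tau) is a polynomial of degree d - 1 *)
(* in sigma, only monomials of degree less than N are summed.                 *)
Lemma residue_jacobian p k j :
  (k + d = N)%N -> p \is k.-homog -> residue (p * fermat_deformation^`M(j)) = 0.
Proof.
move=> kN hp; rewrite mderiv_fermat_deformation -scalerAr linearZ /=.
suff -> : residue (p * ('X_j ^+ d - tau ^- d *: sum_form ^+ d)) = 0.
  by rewrite mulr0.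
have d_gt0 : (0 < d)%N := prim_order_gt0 e_prim.
transitivity (- (tau ^- d) * \sum_(i < d) tau ^+ i *
   \sum_(f : {ffun 'I_n -> 'I_d}) (p * sum_form ^+ (d.-1 - i)).@[root_point e f]
     * coord_prod e f ^+ 1).
  under [in RHS]eq_bigr => i _ do rewrite mulr_sumr.
  rewrite exchange_big mulr_sumr; apply: eq_bigr => f _ /=.
  rewrite mevalM mevalB mevalZ !rmorphXn /= mevalXU meval_sum_form.
  rewrite (root_pointXd e_prim).
  rewrite -/(coord_sum e f) [X in X / _]mulrAC -[LHS]mulrA geometric_quotient.
  rewrite mulrCA; congr (_ * _).
  rewrite !mulr_sumr; apply: eq_bigr => i _.
  rewrite mevalM rmorphXn /= meval_sum_form -/(coord_sum e f) expr1; ring.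
rewrite big1 ?mulr0 // => i _; rewrite (sum_root_point_eq0 e_prim) ?mulr0 //.
move=> a /(dhomog_mf (dhomogM hp (linear_formX_homog _ _))) /= aE.
(* If d divides every a_i + 1, then every a_i is at least d - 1, so a has degree at least n (d - 1)
   = N; but its degree is k + (d - 1 - i) < N. *)
apply: contrapT => /forallNP dv.
have : (\sum_(i < n) d.-1 <= mdeg a)%N.
  rewrite mdegE leq_sum // => l _.
  move/negP: (dv l); rewrite negbK addn1 => /(dvdn_leq (ltn0Sn _)).
  by case: (d).
rewrite sum_nat_const card_ord aE => le.
have : (k + (d.-1 - i) < k + d)%N by rewrite ltn_add2l; lia.
rewrite kN ltnNge (_ : N = n * d.-1)%N ?le //.
by rewrite /N /d; congr (_ * _)%N; lia.
Qed.

(** Since zeta_j ^ (d - 1) is the inverse of zeta_j, the Hessian matrix at zeta is a diagonal matrix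
    minus one of rank at most 1. Its determinant times the product of the zeta_i is thus a multiple
    of 1 - (sigma / tau) ^ d. After division by sigma - tau, only the constant term in sigma
    survives the summation, once for each of the d ^ n points. *)
Lemma residue_hessian : residue (hessian fermat_deformation) =
  - ((m%:R * d%:R) ^+ n * tau ^- d * tau ^+ d.-1 * d%:R ^+ n).
Proof.
have d_gt0 : (0 < d)%N := prim_order_gt0 e_prim.
have d1 : (d = d.-1.+1)%N by rewrite prednK.
have hE (f : {ffun 'I_n -> 'I_d}) :
    (hessian fermat_deformation).@[root_point e f] * coord_prod e f =
    (m%:R * d%:R) ^+ n * (1 - tau ^- d * coord_sum e f ^+ d).
  pose u : 'cV[C]_n := \col_i (tau ^- d * coord_sum e f ^+ d.-1).
  pose v : 'rV[C]_n := \row_j root_point e f j.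
  rewrite /hessian -det_map_mx /=.
  rewrite [map_mx _ _](_ : _ = (m%:R * d%:R) *:
     ((1%:M - u *m v) *m diag_mx (\row_j (root_point e f j)^-1))).
    rewrite detZ det_mulmx det_diag det_1_sub_mulmx -!mulrA; congr (_ * _).
    rewrite -big_split /= big1 ?mulr1 => [|i _]; last first.
      by rewrite !mxE mulVf // (root_point_neq0 e_prim).
    rewrite !mxE; congr (1 - _).
    under eq_bigr => i _ do rewrite !mxE.
    by rewrite -mulr_suml mulrCA -exprS -d1.
  rewrite mul_mx_diag.
  apply/matrixP => i j; rewrite !mxE mderiv2_fermat_deformation mevalZ.
  congr (_ * _).
  rewrite big_ord1 !mxE mevalB mevalM mevalZ !rmorphXn /=.
  rewrite mevalXU meval_sum_form rmorph_nat mulrBl.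
  rewrite mulfK ?(root_point_neq0 e_prim) //.
  congr (_ - _); case: eqP => _; last by rewrite !mul0r.
  rewrite !mul1r; apply: (mulfI (root_point_neq0 e_prim f j)).
  by rewrite -exprS -d1 (root_pointXd e_prim) mulfV ?(root_point_neq0 e_prim).
rewrite /residue; under eq_bigr => f _ do rewrite hE -mulrA geometric_quotient.
rewrite -mulr_sumr -mulr_sumr exchange_big /=.
have pd : (d.-1 < d)%N by rewrite ltn_predL.
(* For i != d - 1, a monomial of sigma ^ (d - 1 - i) has all exponents below d and one of them
   positive, so that one is not divisible by d. *)
rewrite (bigD1 (Ordinal pd)) //= [X in _ + X]big1 => [|i i_neq]; last first.
  rewrite -mulr_suml [\sum_f _](_ : _ = 0) ?mul0r //.
  transitivity (\sum_(f : {ffun 'I_n -> 'I_d})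
     (sum_form ^+ (d.-1 - i)).@[root_point e f] * coord_prod e f ^+ 0).
    by apply: eq_bigr => f _; rewrite expr0 mulr1 rmorphXn /= meval_sum_form.
  apply: (sum_root_point_eq0 e_prim) => a.
  move=> /(dhomog_mf (linear_formX_homog _ _)) /= aE.
  have a_neq0 : a != 0%MM.
    rewrite -mdeg_eq0 aE; move: i_neq; rewrite -val_eqE /=.
    by have := ltn_ord i; lia.
  have [l al] : exists l, a l != 0%N.
    apply/existsP; rewrite -negb_forall; apply: contra a_neq0 => /forallP a0.
    by apply/eqP/mnmP => l; rewrite mnm0E; apply/eqP.
  exists l; rewrite addn0 gtnNdvd ?lt0n //.
  have : (a l <= mdeg a)%N by rewrite mdegE (bigD1 l) //= leq_addr.
  by rewrite aE; lia.
rewrite addr0 subnn; under eq_bigr => f _ do rewrite expr0 mul1r.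
rewrite sumr_const card_ffun !card_ord -[_ *+ (_ ^ _)]mulr_natr natrX; ring.
Qed.

End PowerSumForm.

(** * From a functional in degree N to an associated form *)

Section Omega.
Variables (C : fieldType) (n m : nat) (m_gt2 : (2 < m)%N) (Q : dhomog n C m).
Variable lambda : {linear {mpoly C[n]} -> C | *%R}.
Let N := (n * (m - 2))%N.
Hypothesis lambdaJ : forall p j, lambda (pihomog mdeg N (p * Q^`M(j))) = 0.
Hypothesis lambda_hess : lambda (pihomog mdeg N (hessian Q)) = 1.

(** Only the component of degree N, the socle degree, is evaluated. By [lambdaJ] the choice of the
    representative does not matter. *)
Definition omega_of (x : milnor m_gt2 Q) : C :=
  lambda (pihomog mdeg N (repr x)).

Lemma omega_of_class p :
  omega_of (milnor_class m_gt2 Q p) = lambda (pihomog mdeg N p).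
Proof.
set r := repr (milnor_class m_gt2 Q p).
have : r - p \in jacobian_ideal Q m_gt2.
  by rewrite Quotient.idealrBE reprK.
move=> /asboolP[g rE]; rewrite /omega_of -/r -[r](subrK p) rE.
rewrite pihomogD raddfD /= [X in X + _](_ : _ = 0) ?add0r //.
rewrite (raddf_sum (pihomog mdeg N)) (raddf_sum lambda) big1 // => j _.
exact: lambdaJ.
Qed.

Lemma omega_ofP : is_omega omega_of.
Proof.
split=> [c x y _ _|]; last by rewrite omega_of_class.
rewrite -[x]reprK -[y]reprK; pose cl := milnor_class m_gt2 Q.
rewrite -[_ * _ + _]/(cl c%:MP * cl (repr x) + cl (repr y)).
have -> : cl c%:MP * cl (repr x) + cl (repr y) = cl (c%:MP * repr x + repr y).
  by rewrite /cl /milnor_class rmorphD rmorphM.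
by rewrite !omega_of_class mul_mpolyC !linearP.
Qed.

Lemma associated_formP (F : dhomog n C N) :
  (forall z, F.@[z] = lambda (linear_form z ^+ N)) ->
  is_associated_form m_gt2 Q F.
Proof.
move=> FE; exists omega_of; first exact: omega_ofP.
move=> z; rewrite FE.
have -> : \sum_(j < n) milnor_scalar m_gt2 Q (z j) * milnor_var m_gt2 Q j =
          milnor_class m_gt2 Q (linear_form z).
  rewrite /milnor_class raddf_sum; apply: eq_bigr => j _.
  by rewrite /= -mul_mpolyC rmorphM.
have -> : milnor_class m_gt2 Q (linear_form z) ^+ N =
          milnor_class m_gt2 Q (linear_form z ^+ N).
  by rewrite /milnor_class rmorphXn.
by rewrite omega_of_class pihomog_dE // linear_formX_homog.
Qed.

End Omega.

(** * The associated form of the deformation *)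

Section AssociatedForm.
Variables (C : numFieldType) (n m : nat) (m_gt2 : (2 < m)%N) (tau e : C).
Let d := m.-1.
Let N := (n * (m - 2))%N.
Hypothesis e_prim : d.-primitive_root e.
Hypothesis n_ge2 : (2 <= n)%N.
Hypothesis tau_neq0 : tau != 0.
Hypothesis tauP : forall f : {ffun 'I_n -> 'I_d}, coord_sum e f != tau.

Definition fermat_deformation_form : dhomog n C m :=
  DHomog (fermat_deformation_homog n m tau).

Definition dual_mpoly : {mpoly C[n]} :=
  (residue m tau e (hessian (fermat_deformation n m tau)))^-1 *:
  \sum_(f : {ffun 'I_n -> 'I_d})
     (coord_prod e f / (coord_sum e f - tau)) *:
       linear_form (root_point e f) ^+ N.

Lemma dual_mpoly_homog : dual_mpoly \is N.-homog.
Proof.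
by rewrite rpredZ // rpred_sum // => f _; rewrite rpredZ // linear_formX_homog.
Qed.

Definition dual_form : dhomog n C N := DHomog dual_mpoly_homog.

Lemma residue_hessian_neq0 :
  residue m tau e (hessian (fermat_deformation n m tau)) != 0.
Proof.
rewrite (residue_hessian m_gt2 e_prim tau_neq0 tauP) oppr_eq0 !mulf_neq0 //.
- by rewrite expf_neq0 // mulf_neq0 // pnatr_eq0; lia.
- by rewrite invr_eq0 expf_neq0.
- by rewrite expf_neq0.
- by rewrite expf_neq0 // pnatr_eq0; lia.
Qed.

Definition socle_residue (p : {mpoly C[n]}) : C :=
  (residue m tau e (hessian (fermat_deformation n m tau)))^-1 *
    residue m tau e p.

Lemma socle_residue_is_linear : linear_for *%R socle_residue.
Proof. by move=> c p q; rewrite /socle_residue linearP /=; ring. Qed.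

HB.instance Definition _ :=
  GRing.isLinear.Build C {mpoly C[n]} C *%R socle_residue
    socle_residue_is_linear.

Lemma dual_form_associated :
  is_associated_form m_gt2 fermat_deformation_form dual_form.
Proof.
apply: (@associated_formP C n m m_gt2 fermat_deformation_form socle_residue).
(* From n >= 2 and m >= 3 it follows that d <= N, so the truncated difference N - d is exact. *)
- move=> p j /=; have dN : (N - d + d = N)%N by rewrite subnK // /N /d; nia.
  have hQ : (fermat_deformation n m tau)^`M(j) \is d.-homog.
    rewrite mderiv_fermat_deformation rpredZ //.
    by rewrite rpredB ?rpredZ ?mpolyXU_exp_homog ?linear_formX_homog.
  rewrite -/N -dN (pihomogM _ _ hQ) /socle_residue.
  by rewrite (residue_jacobian _ e_prim _ _ (k := (N - d)%N)) ?mulr0 ?pihomogP.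
- rewrite /= pihomog_dE ?hessian_fermat_deformation_homog //.
  by rewrite /socle_residue mulVf // residue_hessian_neq0.
- move=> z /=; rewrite /dual_mpoly mevalZ (raddf_sum (meval z)).
  rewrite /socle_residue; congr (_ * _); apply: eq_bigr => f _ /=.
  rewrite mevalZ !rmorphXn /= !meval_linear_form mulrC mulrA.
  congr (_ ^+ _ * _ / _).
  by apply: eq_bigr => i _; rewrite mulrC.
Qed.

Lemma dual_mpoly_singular z : (forall j, (dual_mpoly^`M(j)).@[z] = 0) ->
  forall j, \sum_(f : {ffun 'I_n -> 'I_d})
    coord_prod e f / (coord_sum e f - tau) *
      (\sum_i root_point e f i * z i) ^+ N.-1 * root_point e f j = 0.
Proof.
move=> Fz j; have /eqP := Fz j.
have N_gt0 : (0 < N)%N by rewrite /N; nia.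
rewrite mderivZ mevalZ mulf_eq0 invr_eq0 (negPf residue_hessian_neq0) /=.
move=> /eqP Fz0.
apply: (mulfI (_ : N%:R != 0)); first by rewrite pnatr_eq0 -lt0n.
rewrite mulr0 -[RHS]Fz0 (raddf_sum (mderiv j)) (raddf_sum (meval z)) mulr_sumr.
apply: eq_bigr => f _ /=.
rewrite mderivZ mderivXn mderiv_linear_form !mevalZ mevalM mevalC rmorphXn /=.
rewrite meval_linear_form; ring.
Qed.

End AssociatedForm.

(** * A bound for the inverse of the matrix of dominant points *)

Section ScalarPlusOnes.
Variables (C : numFieldType) (n : nat) (om : C).
Hypothesis om_neq1 : om != 1.
Let nu := n%:R - 1 + om.
Hypothesis nu_neq0 : nu != 0.

(** This is the product of w with the matrix having om on the diagonal and 1 elsewhere. *)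
Definition shift_sum (w : 'I_n -> C) k := \sum_i w i + (om - 1) * w k.

Definition shift_bound : C := `|om - 1|^-1 * (1 + n%:R * `|nu|^-1).

Lemma shift_bound_gt0 : 0 < shift_bound.
Proof.
rewrite mulr_gt0 ?invr_gt0 ?normr_gt0 ?subr_eq0 //.
by rewrite ltr_pwDl ?ltr01 // mulr_ge0 ?invr_ge0.
Qed.

(** Summing over k gives nu times the sum of w; once that sum is bounded, w k is read off from its
    own equation. *)
Lemma shift_sum_bound w eta : (forall k, `|shift_sum w k| <= eta) ->
  forall k, `|w k| <= shift_bound * eta.
Proof.
move=> wP k; set s := \sum_i w i.
have sE : s = nu^-1 * \sum_i shift_sum w i.
  rewrite big_split sumr_const card_ord -mulr_sumr -/s -mulr_natl /nu /=.
  by apply: (mulfI nu_neq0); rewrite mulVKf // /nu; ring.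
have sB : `|s| <= `|nu|^-1 * (n%:R * eta).
  rewrite sE normrM normfV ler_wpM2l ?invr_ge0 //.
  rewrite (le_trans (ler_norm_sum _ _ _)) // mulr_natl -[n in leRHS]card_ord.
  by rewrite -sumr_const ler_sum.
have -> : w k = (om - 1)^-1 * (shift_sum w k - s).
  by rewrite /shift_sum addrAC subrr add0r mulKf // subr_eq0.
rewrite normrM normfV /shift_bound -mulrA ler_wpM2l ?invr_ge0 //.
rewrite (le_trans (ler_normB _ _)) // mulrDl mul1r lerD //.
by rewrite mulrAC mulrC.
Qed.

End ScalarPlusOnes.

(** * Nonsingularity for tau close to nu *)

Section Perturbation.
Variables (C : numFieldType) (n d M : nat) (e : C).
Hypothesis e_prim : d.-primitive_root e.
Hypothesis M_gt0 : (0 < M)%N.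
Variable k0 : 'I_d.
Let om := e ^+ k0.
Let nu := n%:R - 1 + om.
Hypothesis om_neq1 : om != 1.
Hypothesis nu_neq0 : nu != 0.
Hypothesis nuP : forall f : {ffun 'I_n -> 'I_d}, coord_sum e f = nu ->
  exists k, forall i, root_point e f i = if i == k then om else 1.

(** For M = N - 1 this is, up to a nonzero constant, the j-th partial derivative of the associated
    form at z. *)
Definition grad_sum tau z j :=
  \sum_(f : {ffun 'I_n -> 'I_d}) coord_prod e f / (coord_sum e f - tau)
     * (\sum_i root_point e f i * z i) ^+ M * root_point e f j.

Lemma ord_d_gt0 : (0 < d)%N. Proof. exact: prim_order_gt0 e_prim. Qed.

Definition spike k : {ffun 'I_n -> 'I_d} :=
  [ffun i => if i == k then k0 else Ordinal ord_d_gt0].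

Lemma root_point_spike k i :
  root_point e (spike k) i = if i == k then om else 1.
Proof. by rewrite /root_point ffunE; case: eqP. Qed.

Lemma coord_sum_spike k : coord_sum e (spike k) = nu.
Proof.
rewrite /coord_sum (bigD1 k) //= root_point_spike eqxx.
under eq_bigr => i /negPf ik do rewrite root_point_spike ik.
rewrite sumr_const cardC1 card_ord addrC /nu; congr (_ + _).
by case: n k => [[]//|n' _]; rewrite -[n'.+1]addn1 natrD addrK addn1.
Qed.

Lemma coord_prod_spike k : coord_prod e (spike k) = om.
Proof.
rewrite /coord_prod (bigD1 k) //= root_point_spike eqxx big1 ?mulr1 //.
by move=> i /negPf ik; rewrite root_point_spike ik.
Qed.

Lemma root_point_inj :
  injective (fun f : {ffun 'I_n -> 'I_d} => root_point e f).
Proof.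
move=> f g fg; apply/ffunP => i; apply/val_inj/eqP.
have /eqP := congr1 (fun h => h i) fg.
by rewrite (eq_prim_root_expr e_prim) !modn_small.
Qed.

Lemma sum_spikes (G : {ffun 'I_n -> 'I_d} -> C) :
  \sum_(f | coord_sum e f == nu) G f = \sum_k G (spike k).
Proof.
rewrite -[RHS]/(\sum_(k in 'I_n) G (spike k)).
rewrite -(big_imset (h := spike) G) /= => [|k l _ _ kl]; last first.
  have := congr1 (fun f => root_point e f k) kl; rewrite !root_point_spike eqxx.
  by case: eqP => // _ /eqP; rewrite (negPf om_neq1).
apply: eq_bigl => f; apply/eqP/imsetP => [/nuP[k fk]|[k _ ->]]; last first.
  exact: coord_sum_spike.
exists k => //; apply: root_point_inj; apply: funext => i.
by rewrite fk root_point_spike.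
Qed.

Lemma norm_root (x : C) : x ^+ d = 1 -> `|x| = 1.
Proof.
move=> xd; apply/eqP; rewrite -(@pexpr_eq1 _ _ d) ?ord_d_gt0 //.
by rewrite -normrX xd normr1.
Qed.

Lemma norm_root_point (f : {ffun 'I_n -> 'I_d}) i : `|root_point e f i| = 1.
Proof. exact: norm_root (root_pointXd e_prim f i). Qed.

Let cst := shift_bound n om.
(* If all |zeta . z| <= eta for the n dominant points zeta, then             *)
(* sum_i |z i| <= n * cst * eta < 1.                                         *)
Let eta := (2 * n.+1%:R * cst)^-1.
(** For tau = nu - delta with delta * K <= 1, this bounds the sum of 1 / |sigma - tau| over the
    points that are not dominant; the 2 comes from [dist_pole_ge]. *)
Let K := \sum_(f : {ffun 'I_n -> 'I_d} | coord_sum e f != nu)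
  2 * `|coord_sum e f - nu|^-1.

(** As 2 / |sigma - nu| is one of the terms of [K], delta is at most |sigma - nu| / 2. *)
Lemma dist_pole_ge delta (f : {ffun 'I_n -> 'I_d}) :
    0 < delta -> delta * K <= 1 -> coord_sum e f != nu ->
  `|coord_sum e f - nu| / 2 <= `|coord_sum e f - (nu - delta)|.
Proof.
move=> delta_gt0 dK fnu; set x := coord_sum e f - nu.
have x_gt0 : 0 < `|x| by rewrite normr_gt0 subr_eq0.
have le_delta : delta <= `|x| / 2.
  have : delta * (2 * `|x|^-1) <= 1.
    apply: le_trans dK; rewrite ler_pM2l // /K (bigD1 f) //= lerDl.
    by apply: sumr_ge0 => g _; rewrite mulr_ge0 ?invr_ge0.
  by rewrite mulrA ler_pdivrMr // mul1r ler_pdivlMr.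
have -> : coord_sum e f - (nu - delta) = x + delta by rewrite /x; ring.
have : `|x| <= `|x + delta| + delta.
  have := ler_normB (x + delta) delta.
  by rewrite addrK (gtr0_norm delta_gt0).
rewrite -lerBlDr; apply: le_trans.
by rewrite lerBrDr [leRHS]splitr lerD2l.
Qed.

(** Let y k be the value of the k-th dominant linear form at z. Multiplied by delta / om, the
    equations say that the matrix sends the powers y k ^ M to terms of size at most delta * K.
    Inverting it makes y small; as y is the image of z under the same matrix, inverting again makes
    z too small to have norm 1. *)
Lemma grad_sum_unit_neq0 delta z :
    0 < delta -> delta * K <= 1 -> cst * (delta * K) <= eta ^+ M ->
    \sum_i `|z i| = 1 ->
  ~ forall j, grad_sum (nu - delta) z j = 0.
Proof.
move=> delta_gt0 dK1 dK2 z1 grad0.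
have cst_gt0 : 0 < cst by exact: shift_bound_gt0.
have eta_gt0 : 0 < eta by rewrite /eta invr_gt0 mulr_gt0 // mulr_gt0 ?ltr0n.
have om1 : `|om| = 1.
  by apply: norm_root; rewrite exprAC (prim_expr_order e_prim) expr1n.
have om_neq0 : om != 0 by rewrite -normr_eq0 om1 oner_eq0.
pose y := shift_sum om z.
have yE k : \sum_i root_point e (spike k) i * z i = y k.
  rewrite /y /shift_sum mulrBl mul1r addrCA (bigD1 k) //= root_point_spike eqxx.
  congr (_ + _); rewrite [X in _ = X - _](bigD1 k) //= addrAC subrr add0r.
  by apply: eq_bigr => i /negPf ik; rewrite root_point_spike ik mul1r.
have yM j : `|shift_sum om (fun k => y k ^+ M) j| <= delta * K.
  have := grad0 j; rewrite /grad_sum (bigID (fun f => coord_sum e f == nu)) /=.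
  rewrite sum_spikes => /eqP; rewrite addr_eq0 => /eqP gradE.
  have -> : shift_sum om (fun k => y k ^+ M) j = (delta / om) *
      \sum_k coord_prod e (spike k) / (coord_sum e (spike k) - (nu - delta)) *
        (\sum_i root_point e (spike k) i * z i) ^+ M * root_point e (spike k) j.
    under eq_bigr => k _ do
      rewrite coord_prod_spike coord_sum_spike yE root_point_spike opprB addrCA
        subrr addr0.
    have -> : shift_sum om (fun k => y k ^+ M) j =
       \sum_k y k ^+ M * (if j == k then om else 1).
      rewrite /shift_sum mulrBl mul1r addrCA (bigD1 j) //=.
      rewrite [in RHS](bigD1 j) //= eqxx.
      rewrite [X in _ = X + _]mulrC; congr (_ + _); rewrite addrAC subrr add0r.
      by apply: eq_bigr => k; rewrite eq_sym => /negPf ->; rewrite mulr1.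
    rewrite [RHS]mulr_sumr; apply: eq_bigr => k _; rewrite -[RHS]mulrA.
    by field; rewrite om_neq0 gt_eqF.
  rewrite gradE mulrN normrN normrM normf_div om1 divr1 (gtr0_norm delta_gt0).
  rewrite ler_pM2l // (le_trans (ler_norm_sum _ _ _)) // ler_sum // => f fnu.
  have f_gt0 : 0 < `|coord_sum e f - nu| by rewrite normr_gt0 subr_eq0.
  rewrite !normrM norm_root_point mulr1 normfV /coord_prod normr_prod.
  rewrite [\prod_i _]big1 ?mul1r => [|i _]; last exact: norm_root_point.
  rewrite -[leRHS]mulr1 ler_pM ?invr_ge0 //.
    rewrite -[2]invrK -invfM lef_pV2 ?posrE ?mulr_gt0 ?invr_gt0 // 1?mulrC.
      exact: dist_pole_ge.
    by rewrite (lt_le_trans _ (dist_pole_ge delta_gt0 dK1 fnu)) ?divr_gt0.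
  rewrite normrX exprn_ile1 // (le_trans (ler_norm_sum _ _ _)) // -z1.
  by apply: ler_sum => i _; rewrite normrM norm_root_point mul1r.
have yB k : `|y k| <= eta.
  have := shift_sum_bound om_neq1 nu_neq0 yM k.
  rewrite normrX => /le_trans/(_ dK2); rewrite ler_pXn2r ?nnegrE // ltW //.
have zB := shift_sum_bound om_neq1 nu_neq0 yB.
have : 1 <= n%:R * (cst * eta).
  rewrite -[leLHS]z1 mulr_natl -[n in leRHS]card_ord -sumr_const ler_sum //.
move=> /le_lt_trans lt1.
suff /lt1 : n%:R * (cst * eta) < 1 by rewrite ltxx.
have -> : n%:R * (cst * eta) = n%:R / (2 * n.+1%:R).
  by rewrite /eta; field; rewrite nat1r pnatr_eq0 (gt_eqF cst_gt0).
by rewrite ltr_pdivrMr ?mulr_gt0 ?ltr0n // mul1r -natrM ltr_nat; lia.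
Qed.

Lemma exists_tau : exists tau : C, [/\ tau != 0,
  forall f : {ffun 'I_n -> 'I_d}, coord_sum e f != tau &
  forall z, (forall j, grad_sum tau z j = 0) -> forall j, z j = 0].
Proof.
have cst_gt0 : 0 < cst by exact: shift_bound_gt0.
have eta_gt0 : 0 < eta by rewrite /eta invr_gt0 mulr_gt0 // mulr_gt0 ?ltr0n.
have K_ge0 : 0 <= K by apply: sumr_ge0 => f _; rewrite mulr_ge0 ?invr_ge0.
(* The three summands of b ensure in turn delta < |nu|, whence tau != 0, then delta * K < 1, and the
   smallness of the remaining terms against eta ^ M. *)
pose b := `|nu|^-1 + K + cst * K * eta ^- M.
have c2 : 0 <= cst * K * eta ^- M.
  rewrite mulr_ge0 ?invr_ge0 ?exprn_ge0 ?(ltW eta_gt0) //.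
  by rewrite mulr_ge0 ?(ltW cst_gt0).
have b_ge0 : 0 <= b by rewrite !addr_ge0 ?invr_ge0.
pose delta := (1 + b)^-1.
have delta_gt0 : 0 < delta by rewrite invr_gt0 ltr_pwDl.
have db c : 0 <= c -> c <= b -> delta * c < 1.
  move=> c0 cb; rewrite mulrC ltr_pdivrMr ?ltr_pwDl // mul1r.
  by rewrite (le_lt_trans cb) // ltrDr.
have dnu : delta < `|nu|.
  have /db : 0 <= `|nu|^-1 by rewrite invr_ge0.
  rewrite ltr_pdivrMr ?normr_gt0 // mul1r; apply.
  by rewrite /b -addrA lerDl addr_ge0.
have dK : delta * K < 1.
  by apply: db; rewrite // /b addrAC lerDr addr_ge0 ?invr_ge0.
have dK2 : cst * (delta * K) <= eta ^+ M.
  rewrite mulrCA -[leRHS]mul1r -ler_pdivrMr ?exprn_gt0 // -mulrA ltW // db //.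
  by rewrite /b lerDr addr_ge0 ?invr_ge0.
exists (nu - delta); split.
- rewrite subr_eq0; apply/eqP => nuE; move: dnu.
  by rewrite nuE gtr0_norm // ltxx.
- move=> f; have [->|fnu] := eqVneq (coord_sum e f) nu.
    by rewrite -subr_eq0 opprB addrCA subrr addr0 gt_eqF.
  rewrite -subr_eq0 -normr_gt0.
  rewrite (lt_le_trans _ (dist_pole_ge delta_gt0 (ltW dK) fnu)) // divr_gt0 //.
  by rewrite normr_gt0 subr_eq0.
move=> z gz j; apply: contrapT => /eqP zj.
pose s := \sum_i `|z i|.
have s_gt0 : 0 < s.
  by rewrite /s (bigD1 j) //= ltr_pwDl ?normr_gt0 // sumr_ge0.
(* [grad_sum] is homogeneous of degree M in z, so a nonzero zero can be scaled to norm 1. *)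
apply: (@grad_sum_unit_neq0 delta (fun i => z i / s)) => //; first exact: ltW.
  under eq_bigr => i _ do rewrite normrM normfV (gtr0_norm s_gt0).
  by rewrite -mulr_suml mulfV // gt_eqF.
move=> l; rewrite -[RHS](mulr0 (s ^- M)) -(gz l) mulr_sumr.
apply: eq_bigr => f _.
under eq_bigr => i _ do rewrite mulrA.
by rewrite -mulr_suml exprMn exprVn; ring.
Qed.

End Perturbation.

(** * The choice of the root om *)

Lemma closed_prim_root_exists (C : numClosedFieldType) d :
  (0 < d)%N -> exists e : C, d.-primitive_root e.
Proof.
pose p : {poly C} := 'X^d - 1; have [r Dp] := closed_field_poly_normal p.
move=> d_gt0; rewrite (monicP _) ?monicXnsubC // scale1r in Dp.
have r1 : all d.-unity_root r by apply/allP=> z; rewrite -root_prod_XsubC -Dp.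
have sz_r : (d < (size r).+1)%N.
  by rewrite -(size_prod_XsubC r id) -Dp size_XnsubC.
have [|z] := hasP (has_prim_root d_gt0 r1 _ sz_r); last by exists z.
by rewrite -separable_prod_XsubC -Dp separable_Xn_sub_1 // pnatr_eq0 -lt0n.
Qed.

Section ExtremeRoot.
Variables (R : rcfType) (d : nat) (e : R[i]).
Hypothesis e_prim : d.-primitive_root e.
Hypothesis d_gt1 : (1 < d)%N.

Lemma Re_lt1 (x : R[i]) : `|x| = 1 -> x != 1 -> complex.Re x < 1.
Proof.
move=> nx xN1.
have := add_Re2_Im2 x; rewrite nx expr1n => /(congr1 (@complex.Re R)) /= x1.
rewrite ltNge; apply/negP => Rex.
have Imx : complex.Im x = 0.
  apply/eqP; rewrite -sqrf_eq0 eq_le sqr_ge0 andbT.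
  rewrite -(lerD2l (complex.Re x ^+ 2)).
  by rewrite x1 addr0 exprn_ege1.
have Rex1 : complex.Re x = 1.
  move: x1; rewrite Imx expr0n addr0 => /eqP.
  rewrite sqrf_eq1 => /orP[/eqP//|/eqP x1].
  by move: Rex; rewrite x1; lra.
by case/eqP: xN1; apply/eqP; rewrite eq_complex Rex1 Imx !eqxx.
Qed.

Lemma extreme_root : exists2 k0 : 'I_d, e ^+ k0 != 1 &
  forall k : 'I_d, e ^+ k != 1 -> complex.Re (e ^+ k) <= complex.Re (e ^+ k0).
Proof.
have e1 : e ^+ Ordinal d_gt1 != 1.
  by rewrite /= -(prim_order_dvd e_prim) gtnNdvd.
case: (@Order.TotalTheory.arg_maxP _ _ _ (Ordinal d_gt1)
  (fun k : 'I_d => e ^+ k != 1) (fun k => complex.Re (e ^+ k)) e1).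
by move=> k0 k01 k0P; exists k0.
Qed.

(** Coordinates equal to 1 have deficit Re (1 - zeta_i) = 0, and all others at least rho = Re (1 -
    om) > 0. The deficits add up to rho, so exactly one coordinate differs from 1, and the value of
    the sum forces it to be om. *)
Lemma sum_roots_extreme n (k0 : 'I_d) (f : {ffun 'I_n -> 'I_d}) :
    e ^+ k0 != 1 ->
    (forall k : 'I_d,
       e ^+ k != 1 -> complex.Re (e ^+ k) <= complex.Re (e ^+ k0)) ->
    coord_sum e f = n%:R - 1 + e ^+ k0 ->
  exists k, forall i, root_point e f i = if i == k then e ^+ k0 else 1.
Proof.
move=> k01 k0P fE.
pose D i : R := complex.Re (1 - root_point e f i).
pose rho : R := complex.Re (1 - e ^+ k0).
have rho_gt0 : 0 < rho.
  rewrite /rho raddfB /= subr_gt0 Re_lt1 // (norm_root e_prim) //.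
  by rewrite exprAC (prim_expr_order e_prim) expr1n.
have DP i : root_point e f i != 1 -> rho <= D i.
  by move=> /k0P; rewrite /rho /D !raddfB /= lerD2l lerN2.
have D_ge0 i : 0 <= D i.
  have [fi|/DP] := eqVneq (root_point e f i) 1; first by rewrite /D fi subrr.
  by apply: le_trans; exact: ltW.
have DS : \sum_i D i = rho.
  rewrite /D -raddf_sum /= sumrB sumr_const card_ord -/(coord_sum e f) fE.
  by rewrite /rho; congr complex.Re; ring.
have [k fk] : exists k, root_point e f k != 1.
  apply/existsP; apply: contraPT rho_gt0; rewrite negb_exists => /forallP f1.
  rewrite -DS big1 ?ltxx // => i _; move: (f1 i); rewrite negbK => /eqP fi.
  by rewrite /D fi subrr.
have f1 i : i != k -> root_point e f i = 1.
  move=> ik; apply/eqP; apply: contraT => /DP rDi.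
  have : rho + rho <= rho.
    rewrite -[leRHS]DS (bigD1 k) //= (bigD1 i) //= addrA.
    rewrite ler_wpDr ?lerD ?rDi ?DP //.
    by apply: sumr_ge0.
  by rewrite gerDl leNgt rho_gt0.
exists k => i; case: eqP => [->|/eqP/f1//].
move: fE; rewrite /coord_sum (bigD1 k) //= (eq_bigr (fun=> 1)) => [|? /f1//].
rewrite sumr_const cardC1 card_ord addrC.
have -> : (n.-1)%:R = n%:R - 1 :> R[i].
  by rewrite -subn1 natrB // (leq_ltn_trans (leq0n k)).
by move/addrI.
Qed.

(** If nu = 0, then om = 1 - n has modulus 1, so n = 2 and om = -1. By maximality of its real part
    Re e <= -1, hence e = -1, which is impossible for d > 2. *)
Lemma nu_neq0 n (k0 : 'I_d) : (1 < n)%N -> (2 < n)%N || (2 < d)%N ->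
    (forall k : 'I_d,
       e ^+ k != 1 -> complex.Re (e ^+ k) <= complex.Re (e ^+ k0)) ->
  n%:R - 1 + e ^+ k0 != 0 :> R[i].
Proof.
move=> n_gt1 nd k0P; apply/eqP => nu0.
have rootX k : (e ^+ k) ^+ d = 1.
  by rewrite exprAC (prim_expr_order e_prim) expr1n.
have omE : e ^+ k0 = - (n.-1)%:R.
  apply/eqP; rewrite -addr_eq0 addrC -nu0 -subn1 natrB //; lia.
have : (n.-1 == 1)%N.
  have := norm_root e_prim (rootX k0); rewrite omE normrN normr_nat => /eqP.
  by rewrite pnatr_eq1.
move=> /eqP n1; have d_gt2 : (2 < d)%N by move: nd; lia.
rewrite n1 in omE.
have Ree : complex.Re (e ^+ 1) <= -1.
  have -> : -1 = complex.Re (e ^+ k0) by rewrite omE raddfN.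
  apply: (k0P (Ordinal d_gt1)); rewrite /= -(prim_order_dvd e_prim) gtnNdvd //.
have : complex.Re (- e) < 1.
  rewrite Re_lt1 ?normrN ?(norm_root e_prim) ?(prim_expr_order e_prim) //.
  apply/eqP => eN1; have : (e ^+ 2 == 1).
    by rewrite -sqrrN eN1 expr1n.
  by rewrite -(prim_order_dvd e_prim) gtnNdvd.
by rewrite raddfN /= ltrNl ltNge Ree.
Qed.

End ExtremeRoot.

(** * Binary cubics, where nu = 0 *)

Section BinaryQuadratic.
Variables (C : numFieldType) (e : C).
Hypothesis e_prim : 2.-primitive_root e.

Lemma prim2_eqN1 : e = -1.
Proof.
have /eqP := prim_expr_order e_prim; rewrite sqrf_eq1 => /orP[/eqP e1|/eqP//].
by have := prim_order_dvd e_prim 1; rewrite expr1 e1 eqxx.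
Qed.

Lemma sum_pair_ffun (G : {ffun 'I_2 -> 'I_2} -> C) :
  \sum_f G f = \sum_a \sum_b G [ffun i => if i == 0 then a else b].
Proof.
rewrite pair_big /= (reindex (fun p : 'I_2 * 'I_2 =>
  [ffun i : 'I_2 => if i == 0 then p.1 else p.2])) //=.
exists (fun f : {ffun 'I_2 -> 'I_2} => (f 0, f 1)) => [[a b] _|f _].
  by rewrite !ffunE.
apply/ffunP => i; rewrite ffunE.
by case: i => [[|[|//]] i2] /=; congr (f _); apply: val_inj.
Qed.

(** For tau = 1, which avoids the values 2, 0, -2 of sigma, the weighted sum of squares is 2/3 (x +
    y)^2 + 2 (x - y)^2, a nondegenerate quadratic form. *)
Lemma exists_tau_binary : exists tau : C, [/\ tau != 0,
  forall f : {ffun 'I_2 -> 'I_2}, coord_sum e f != tau &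
  forall z, (forall j, @grad_sum C 2 2 1 e tau z j = 0) -> forall j, z j = 0].
Proof.
exists 1; split; first exact: oner_neq0.
  move=> f; rewrite /coord_sum !big_ord_recl big_ord0 addr0.
  have zt1 i : root_point e f i = 1 \/ root_point e f i = -1.
    have /eqP := root_pointXd e_prim f i; rewrite sqrf_eq1.
    by case/orP => /eqP; [left|right].
  case: (zt1 ord0) => ->; case: (zt1 (lift ord0 ord0)) => ->.
  - by rewrite -subr_eq0 addrK oner_neq0.
  - by rewrite subrr eq_sym oner_neq0.
  - by rewrite addNr eq_sym oner_neq0.
  - rewrite -subr_eq0 (_ : -1 - 1 - 1 = - 3%:R); last by ring.
    by rewrite oppr_eq0 pnatr_eq0.
move=> z gz.
have g0 := gz 0; have g1 := gz 1.
move: g0 g1; rewrite /grad_sum !sum_pair_ffun.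
rewrite /coord_prod /coord_sum /root_point.
rewrite !big_ord_recl !big_ord0 /= !ffunE /= prim2_eqN1.
set x := z ord0; set y := z (lift ord0 ord0); rewrite -[bump 0 0]/1%N.
set A := (X in X = 0 -> _); set B := (X in _ -> X = 0 -> _) => A0 B0.
have n3 : -3 != 0 :> C by rewrite oppr_eq0 pnatr_eq0.
have xE : 4 * x = 2 * A + B.
  by rewrite /A /B; field.
have yE : 4 * y = A + 2 * B.
  by rewrite /A /B; field.
have z0 (t : C) : 4 * t = 0 -> t = 0.
  by move/eqP; rewrite mulf_eq0 pnatr_eq0 /= => /eqP.
move: xE yE; rewrite A0 B0 !(mulr0, addr0) => /z0 x0 /z0 y0 j.
case: j => [[|[|//]] j2]; [rewrite -[RHS]x0|rewrite -[RHS]y0]; congr z;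
  exact: val_inj.
Qed.

End BinaryQuadratic.

Theorem proposition4p3 (R : realType) (n m : nat)
    (n_ge2 : (2 <= n)%N) (m_ge3 : (3 <= m)%N)
    (Delta : forall d : nat, dhomog n R[i] d -> R[i])
    (DeltaP : is_discriminant Delta) :
  exists Q : dhomog n R[i] m,
    Delta m Q != 0 /\
    exists F : dhomog n R[i] (n * (m - 2)),
      is_associated_form m_ge3 Q F /\ Delta (n * (m - 2))%N F != 0.
Proof.
have d_gt1 : (1 < m.-1)%N by lia.
have [e e_prim] := closed_prim_root_exists R[i] (ltnW d_gt1).
have [tau [tau0 tauP gradP]] : exists tau : R[i], [/\ tau != 0,
    forall f : {ffun 'I_n -> 'I_m.-1}, coord_sum e f != tau &
    forall z, (forall j : 'I_n, grad_sum m.-1 (n * (m - 2)).-1 e tau z j = 0) ->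
      forall j, z j = 0].
  have [nd|] := boolP ((2 < n)%N || (2 < m.-1)%N).
    have [k0 k01 k0P] := extreme_root e_prim d_gt1.
    apply: (exists_tau e_prim _ k01); first by nia.
      exact: nu_neq0.
    by move=> f; apply: sum_roots_extreme.
  rewrite negb_or => nd; have [n2 m3] : n = 2%N /\ m = 3%N by lia.
  move: e_prim; subst n m => e_prim; exact: exists_tau_binary.
exists (fermat_deformation_form n m tau); split.
  apply/DeltaP; first exact: ltnW.
  case=> z [[j /eqP zj] Qz]; apply: zj.
  exact: (fermat_deformation_nonsingular m_ge3 e_prim tau0 tauP Qz).
exists (dual_form n m tau e); split.
  exact: dual_form_associated.
apply/DeltaP; first by nia.
case=> z [[j /eqP zj] Fz]; apply/zj/gradP => l.
exact: (dual_mpoly_singular m_ge3 e_prim n_ge2 tau0 tauP Fz).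
Qed.
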